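(* For every nonnegative matrix $M\in\mathbb{R}^{p\times q}$ and every $\eta\in(0,1]$, there exist symmetric psd matrices $\{P_i\}_{i\in[p]}$ and $\{Q_j\}_{j\in[q]}$ (all of the same size) such that: (1) $M_{i,j}\le\mathrm{Tr}(P_iQ_j)\le M_{i,j}+\eta\|M\|_\infty$ for all $i,j$; (2) $\frac1p\sum_{i=1}^pP_i=\mathrm{Id}$; (3) $\|P_i\|\le 2\,\mathrm{rk}_{\mathsf{psd}}(M)^2/\eta$ for all $i\in[p]$; (4) $Q_j\preceq\|M\|_\infty(\eta+\mathrm{rk}_{\mathsf{psd}}(M)^2)\,\mathrm{rk}_{\mathsf{psd}}(M)\,\mathcal U$ for all $j\in[q]$.
   Context: $\mathrm{rk}_{\mathsf{psd}}(M)$ is the smallest $r$ such that $M_{ij}=\mathrm{Tr}(A_iB_j)$ for symmetric psd $r\times r$ matrices $A_i,B_j$. $\|M\|_\infty$ is the maximum absolute entry of $M$; $\|P\|$ is the operator norm; $\preceq$ is the Loewner order; $\mathcal U=\mathrm{Id}/\mathrm{Tr}(\mathrm{Id})$ is the uniform density matrix of the same dimension as the $Q_j$. *)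

(* Defs.v *)
From HB Require Import structures.
From mathcomp Require Import all_boot all_order all_algebra.
From mathcomp Require Import boolp classical_sets reals.

Set Implicit Arguments.
Unset Strict Implicit.
Unset Printing Implicit Defensive.

Import Order.TTheory GRing.Theory Num.Theory.
Local Open Scope ring_scope.

Section Matrices.
Variables (R : realType) (n : nat).
Implicit Types A B : 'M[R]_n.

Definition psdmx A : Prop :=
  A^T = A /\ forall x : 'cV[R]_n, 0 <= (x^T *m A *m x) 0 0.

Definition loewner_le A B : Prop := psdmx (B - A).

Definition l2norm (x : 'cV[R]_n) : R := Num.sqrt (\sum_i x i 0 ^+ 2).

(* For n = 0 this is Id / 0 = 0 on the zero-dimensional space. *)
Definition uniform_density : 'M[R]_n := (\tr (1%:M : 'M[R]_n))^-1 *: 1%:M.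

End Matrices.

Arguments uniform_density {R} n.

Definition opnorm (R : realType) (n : nat) (A : 'M[R]_n) : R :=
  sup [set l2norm (A *m x) | x in [set x | l2norm x <= 1]]%classic.

Lemma opnorm_has_sup (R : realType) (n : nat) (A : 'M[R]_n) :
  has_sup [set l2norm (A *m x) | x in [set x | l2norm x <= 1]]%classic.
Proof.
split.
  exists (l2norm (A *m 0)), 0 => //=.
  rewrite /l2norm big1 ?sqrtr0 ?ler01 // => i _.
  by rewrite mxE expr0n.
exists (Num.sqrt (\sum_i (\sum_j `|A i j|) ^+ 2)) => _ [x /= x1 <-].
rewrite /l2norm ler_wsqrtr //; apply: ler_sum => i _.
rewrite -(ler_sqrt _ (sqr_ge0 _)) !sqrtr_sqr [leRHS]ger0_norm ?sumr_ge0 //.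
rewrite mxE (le_trans (ler_norm_sum _ _ _)) //; apply: ler_sum => j _.
rewrite normrM ler_piMr // (le_trans _ x1) // /l2norm -sqrtr_sqr ler_wsqrtr //.
by rewrite (bigD1 j) //= lerDl sumr_ge0 // => k _; rewrite sqr_ge0.
Qed.

Section PsdRank.
Variables (R : realType) (p q : nat).
Implicit Type M : 'M[R]_(p, q).

Definition nonneg_mx M : Prop := forall i j, 0 <= M i j.

Definition has_psd_factorization M (r : nat) : Prop :=
  exists (A : 'I_p -> 'M[R]_r) (B : 'I_q -> 'M[R]_r),
    [/\ forall i, psdmx (A i), forall j, psdmx (B j)
      & forall i j, M i j = \tr (A i *m B j)].

(* The junk value 0 is taken only when M has no factorization at all, which
   does not happen for nonnegative M; see psd_rankP. *)
Definition psd_rank M : nat :=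
  if pselect (exists r, `[< has_psd_factorization M r >]) is left ex
  then ex_minn ex else 0%N.

Lemma nonneg_has_psd_factorization M :
  nonneg_mx M -> has_psd_factorization M q.
Proof.
move=> M0.
have psd_diag (d : 'rV[R]_q) : (forall k, 0 <= d 0 k) -> psdmx (diag_mx d).
  move=> d0; split=> [|x]; first by rewrite tr_diag_mx.
  rewrite mxE sumr_ge0 // => k _; rewrite mul_mx_diag !mxE mulrAC -expr2.
  by rewrite mulr_ge0 ?sqr_ge0.
exists (fun i => diag_mx (row i M)), (fun j => diag_mx (delta_mx 0 j)).
split=> [i|j|i j].
- by apply: psd_diag => k; rewrite mxE.
- by apply: psd_diag => k; rewrite mxE ler0n.
- rewrite mulmx_diag mxtrace_diag (bigD1 j) //= big1 => [|k kj].
    by rewrite !mxE !eqxx mulr1 addr0.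
  by rewrite !mxE eqxx (negPf kj) mulr0.
Qed.

Lemma psd_rankP M : nonneg_mx M ->
  has_psd_factorization M (psd_rank M) /\
  forall r, has_psd_factorization M r -> (psd_rank M <= r)%N.
Proof.
move=> M0; rewrite /psd_rank; case: pselect => [ex|[]]; last first.
  by exists q; apply/asboolP; exact: nonneg_has_psd_factorization.
case: ex_minnP => r /asboolP Mr minr; split=> // s /asboolP; exact: minr.
Qed.

End PsdRank.

(* Main.v *)
Require Import Defs.
From mathcomp Require Import all_boot all_order all_algebra.
From mathcomp Require Import reals matrix_normedtype.
From mathcomp Require Import boolp classical_sets cardinality topology.
From mathcomp Require Import normedtype derive ring lra.

Import Order.TTheory GRing.Theory Num.Theory.
Import numFieldNormedType.Exports.
Local Open Scope classical_set_scope.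
Local Open Scope ring_scope.

(* Start from a factorization M_ij = Tr(A_i B_j) of size r = rk_psd(M). Among the
   matrices X whose rows lie in K, the union over i of {x : x x^T <= A_i}, choose
   one of maximal |det X|; it is invertible because r is minimal. By Cramer's
   rule every x in K is a combination of the rows of X with coefficients in
   [-1, 1], so if row k belongs to the ellipsoid of A_(f k), Cauchy-Schwarz gives
   A_i <= r^2 S, where S is the mean of the A_(f k) (this barycentric spanner
   replaces John's theorem). Moreover Tr(S B_j) is a mean of entries of M.
   Let G = (1/p) sum_i A_i + eta S and T^T G T = Id; then
     P_i = T^T (A_i + eta S) T  and  Q_j = T^-1 B_j T^-T
   work: A_i + eta S <= (r^2 + eta) S <= (r^2 + eta) / eta G bounds P_i, and
   Q_j <= Tr(Q_j) Id with Tr(Q_j) = Tr(G B_j) <= (1 + eta) |M|. *)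

(** * Bilinear forms of matrices *)

Definition bform {R : realType} {n : nat} (A : 'M[R]_n) (x y : 'cV[R]_n) : R :=
  (x^T *m A *m y) 0 0.

Lemma bformDl (R : realType) n (A : 'M[R]_n) x y z :
  bform A (x + y) z = bform A x z + bform A y z.
Proof. by rewrite /bform linearD /= !mulmxDl mxE. Qed.

Lemma bformZl (R : realType) n (A : 'M[R]_n) a x z :
  bform A (a *: x) z = a * bform A x z.
Proof. by rewrite /bform linearZ /= -!scalemxAl mxE. Qed.

Lemma bformDr (R : realType) n (A : 'M[R]_n) x y z :
  bform A x (y + z) = bform A x y + bform A x z.
Proof. by rewrite /bform mulmxDr mxE. Qed.

Lemma bformZr (R : realType) n (A : 'M[R]_n) a x z :
  bform A x (a *: z) = a * bform A x z.
Proof. by rewrite /bform -!scalemxAr mxE. Qed.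

Lemma bformC (R : realType) n (A : 'M[R]_n) x y :
  A^T = A -> bform A x y = bform A y x.
Proof.
move=> sA; rewrite /bform -[in RHS]sA.
by rewrite -[in RHS](trmxK x) -mulmxA -!trmx_mul mulmxA [RHS]mxE.
Qed.

Lemma bformMD (R : realType) n (A B : 'M[R]_n) x y :
  bform (A + B) x y = bform A x y + bform B x y.
Proof. by rewrite /bform mulmxDr mulmxDl mxE. Qed.

Lemma bformMZ (R : realType) n (A : 'M[R]_n) a x y :
  bform (a *: A) x y = a * bform A x y.
Proof. by rewrite /bform -scalemxAr -scalemxAl mxE. Qed.

Lemma bformMsum (R : realType) n (I : finType) (A : I -> 'M[R]_n) x y :
  bform (\sum_i A i) x y = \sum_i bform (A i) x y.
Proof. by rewrite /bform mulmx_sumr mulmx_suml summxE. Qed.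

Lemma bform1 (R : realType) n (x : 'cV[R]_n) :
  bform 1%:M x x = \sum_i x i 0 ^+ 2.
Proof.
by rewrite /bform mulmx1 mxE; apply: eq_bigr => i _; rewrite mxE expr2.
Qed.

Lemma bform_congr (R : realType) m n (A : 'M[R]_m) (T : 'M[R]_(m, n)) x y :
  bform (T^T *m A *m T) x y = bform A (T *m x) (T *m y).
Proof. by rewrite /bform trmx_mul !mulmxA. Qed.

Lemma bform_delta (R : realType) n (A : 'M[R]_n) i j :
  bform A (delta_mx i 0) (delta_mx j 0) = A i j.
Proof. by rewrite /bform trmx_delta -rowE -colE !mxE. Qed.

(** * Positive semidefinite matrices: closure properties and inequalities *)

Lemma psdmx_congr (R : realType) m n (A : 'M[R]_m) (T : 'M[R]_(m, n)) :
  psdmx A -> psdmx (T^T *m A *m T).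
Proof.
case=> sA A0; split=> [|x]; first by rewrite !trmx_mul trmxK sA mulmxA.
by rewrite -/(bform _ x x) bform_congr; apply: A0.
Qed.

Lemma psdmxD (R : realType) n (A B : 'M[R]_n) :
  psdmx A -> psdmx B -> psdmx (A + B).
Proof.
move=> [sA A0] [sB B0]; split=> [|x]; first by rewrite linearD /= sA sB.
by rewrite -/(bform _ x x) bformMD addr_ge0 //; [apply: A0|apply: B0].
Qed.

Lemma psdmxZ (R : realType) n (A : 'M[R]_n) a :
  0 <= a -> psdmx A -> psdmx (a *: A).
Proof.
move=> a0 [sA A0]; split=> [|x]; first by rewrite linearZ /= sA.
by rewrite -/(bform _ x x) bformMZ mulr_ge0 //; apply: A0.
Qed.

Lemma psdmx_sum (R : realType) n (I : finType) (A : I -> 'M[R]_n) :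
  (forall i, psdmx (A i)) -> psdmx (\sum_i A i).
Proof.
move=> psdA; apply: (big_ind (@psdmx R n)) => [|B C|//]; last exact: psdmxD.
by split=> [|x]; rewrite ?trmx0 // mulmx0 mul0mx mxE.
Qed.

(** The quadratic in [t] given by [A] at [x + t *: y] is nonnegative, so its discriminant is not
    positive. *)
Lemma psdmx_cauchy_schwarz (R : realType) n (A : 'M[R]_n) x y : psdmx A ->
  bform A x y ^+ 2 <= bform A x x * bform A y y.
Proof.
move=> [sA A0].
have q t : 0 <= bform A x x + 2 * t * bform A x y + t ^+ 2 * bform A y y.
  have := A0 (x + t *: y); rewrite -/(bform _ _ _).
  rewrite bformDl !bformDr !bformZl !bformZr (bformC _ _ A y x) //; lra.
move: (A0 x) (A0 y); rewrite -!/(bform _ _ _) => x0 y0.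
have [c0|c_neq0] := eqVneq (bform A y y) 0; last first.
  have c_gt0 : 0 < bform A y y by rewrite lt_neqAle eq_sym c_neq0.
  have := q (- (bform A x y / bform A y y)).
  rewrite -(ler_pM2r c_gt0) mul0r => H; rewrite -subr_ge0.
  by apply: le_trans H _; rewrite le_eqVlt; apply/orP; left; apply/eqP; field.
have [->|b_neq0] := eqVneq (bform A x y) 0; first by rewrite expr0n c0 mulr0.
(* With no quadratic term left, the affine function takes the value -1 at this [t]. *)
have := q (- ((bform A x x + 1) / (2 * bform A x y))); rewrite c0 => H.
exfalso; suff: 0 <= (-1 : R) by lra.
by apply: le_trans H _; rewrite le_eqVlt; apply/orP; left; apply/eqP; field.
Qed.

(* Lagrange's identity: the difference of the two sides is half the sum over
   (i, j) of the values of Q on x_j e_i - x_i e_j. *)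
Lemma psdmx_le_trace (R : realType) n (Q : 'M[R]_n) x : psdmx Q ->
  bform Q x x <= \tr Q * bform 1%:M x x.
Proof.
move=> [sQ Q0].
pose u i j : 'cV[R]_n := x j 0 *: delta_mx i 0 + (- x i 0) *: delta_mx j 0.
have uE i j : bform Q (u i j) (u i j) =
    Q i i * x j 0 ^+ 2 + Q j j * x i 0 ^+ 2 - 2 * (x i 0 * Q i j * x j 0).
  rewrite /u bformDl !bformDr !bformZl !bformZr !bform_delta.
  have -> : Q j i = Q i j by rewrite -[in LHS]sQ mxE.
  by ring.
have: 0 <= \sum_i \sum_j bform Q (u i j) (u i j).
  by rewrite sumr_ge0 // => i _; rewrite sumr_ge0 // => j _; apply: Q0.
have E1 : \sum_i \sum_j Q i i * x j 0 ^+ 2 = \tr Q * bform 1%:M x x.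
  rewrite bform1 /mxtrace mulr_suml.
  by apply: eq_bigr => i _; rewrite mulr_sumr.
have E2 : \sum_i \sum_j Q j j * x i 0 ^+ 2 = \tr Q * bform 1%:M x x.
  by rewrite -E1 exchange_big.
have E3 : \sum_i \sum_j (x i 0 * Q i j * x j 0) = bform Q x x.
  rewrite /bform mxE exchange_big; apply: eq_bigr => j _.
  by rewrite mxE mulr_suml; apply: eq_bigr => i _; rewrite mxE.
have -> : \sum_i \sum_j bform Q (u i j) (u i j) =
    \tr Q * bform 1%:M x x + \tr Q * bform 1%:M x x - 2 * bform Q x x.
  rewrite -{1}E1 -E2 -E3 mulr_sumr -big_split /= -sumrB.
  apply: eq_bigr => i _; rewrite mulr_sumr -big_split /= -sumrB.
  by apply: eq_bigr => j _; rewrite uE.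
lra.
Qed.

Lemma psdmx_diag_ge0 (R : realType) n (A : 'M[R]_n) k : psdmx A -> 0 <= A k k.
Proof. by move=> psdA; rewrite -bform_delta; apply: psdA.2. Qed.

Lemma psdmx_trace_ge0 (R : realType) n (A : 'M[R]_n) : psdmx A -> 0 <= \tr A.
Proof. by move=> psdA; rewrite sumr_ge0 // => k _; exact: psdmx_diag_ge0. Qed.

Lemma psdmx_diag_le_sum_trace (R : realType) n (I : finType) (A : I -> 'M[R]_n)
    i k : (forall i, psdmx (A i)) -> A i k k <= \sum_j \tr (A j).
Proof.
move=> psdA; rewrite (bigD1 i) //= {1}/mxtrace (bigD1 k) //= -addrA lerDl.
apply: addr_ge0; rewrite sumr_ge0 // => l _; first exact: psdmx_diag_ge0.
exact: psdmx_trace_ge0.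
Qed.

(** With y = P x and |x| <= 1, Cauchy-Schwarz for [P] gives |y|^4 = (y^T P x)^2 <= (y^T P y)(x^T P
    x) <= c^2 |y|^2; divide by |y|^2. *)
Lemma opnorm_le (R : realType) n (P : 'M[R]_n) c : 0 <= c -> psdmx P ->
  (forall x, bform P x x <= c * bform 1%:M x x) -> opnorm P <= c.
Proof.
move=> c0 psdP Pc; apply: ge_sup; first by have [] := opnorm_has_sup P.
move=> _ [x /= x1 <-].
have n0 (z : 'cV[R]_n) : 0 <= bform 1%:M z z.
  by rewrite bform1 sumr_ge0 // => i _; rewrite sqr_ge0.
have xle1 : bform 1%:M x x <= 1.
  rewrite bform1 -(sqr_sqrtr (_ : 0 <= \sum_i x i 0 ^+ 2)) -?bform1 //.
  by rewrite bform1 expr_le1 // sqrtr_ge0.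
set y := P *m x.
have yE : bform P y x = bform 1%:M y y by rewrite /bform mulmx1 mulmxA.
have [s0 y0] := psdP.
have CS := psdmx_cauchy_schwarz _ _ _ y x psdP; rewrite yE in CS.
have cc : bform P y y * bform P x x <= c * bform 1%:M y y * c.
  apply: ler_pM; [exact: y0|exact: y0|exact: Pc|].
  by apply: le_trans (Pc x) _; rewrite ler_piMr.
rewrite /l2norm -bform1 -(ger0_norm c0) -sqrtr_sqr ler_wsqrtr //.
have [->|yn0] := eqVneq (bform 1%:M y y) 0; first by rewrite sqr_ge0.
have ypos : 0 < bform 1%:M y y by rewrite lt_neqAle eq_sym yn0 n0.
by rewrite -(ler_pM2r ypos); have := le_trans CS cc; lra.
Qed.

(** * Congruence of a positive definite matrix to the identity *)

(** Induction on the size, as in Cholesky's factorization: clear the first row and column, scale the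
    pivot to 1 and recurse on the Schur complement. *)
Lemma posdef_congr1 (R : realType) n (G : 'M[R]_n) : G^T = G ->
  (forall x, x != 0 -> 0 < bform G x x) ->
  exists T : 'M[R]_n, T^T *m G *m T = 1%:M.
Proof.
elim: n G => [|n IH] G sG G0.
  by exists 1%:M; apply/matrixP => -[].
have {IH} : exists T : 'M[R]_(1 + n), T^T *m (G : 'M[R]_(1 + n)) *m T = 1%:M.
  move: G sG G0; rewrite -[n.+1]/(1 + n)%N => G sG G0.
  pose a := G 0 0.
  have a_gt0 : 0 < a.
    have := G0 (delta_mx 0 0); rewrite bform_delta; apply.
    by apply/eqP => /matrixP/(_ 0 0)/eqP; rewrite !mxE oner_eq0.
  pose w := ursubmx G : 'rV[R]_n; pose D := drsubmx G.
  have GE : G = block_mx a%:M w w^T D.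
    rewrite -[LHS]submxK /w trmx_ursub sG; congr block_mx.
    by rewrite [LHS]mx11_scalar !mxE; congr (G _ _)%:M; apply: val_inj.
  have sD : D^T = D by rewrite /D trmx_drsub sG.
  pose E : 'M[R]_(1 + n) := block_mx 1%:M (- a^-1 *: w) 0 1%:M.
  pose H := D - a^-1 *: (w^T *m w).
  have GH : E^T *m G *m E = block_mx a%:M 0 0 H.
    rewrite GE /E tr_block_mx !mulmx_block !trmx0 !trmx1 !mul1mx !mul0mx.
    rewrite !mulmx0 !mulmx1 !addr0 mul_mx_scalar -scalemxAr mul_scalar_mx.
    have -> : (- a^-1 *: w)^T = - a^-1 *: w^T by rewrite linearZ.
    rewrite !scalerA mulNr mulVf ?mulrN ?divff ?gt_eqF // !scaleN1r !addNr.
    by rewrite mul0mx add0r -scalemxAl scaleNr addrC.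
  have sH : H^T = H by rewrite /H linearB linearZ /= trmx_mul trmxK sD.
  (* The Schur complement [H] at [x] is [G] at [E *m col_mx 0 x], which is nonzero because its lower
     block is [x]. *)
  have H0 x : x != 0 -> 0 < bform H x x.
    move=> xn0; pose z : 'cV[R]_(1 + n) := col_mx 0 x.
    have : bform (E^T *m G *m E) z z = bform H x x.
      rewrite GH /bform tr_col_mx mul_row_block mul_row_col.
      by rewrite !mulmx0 !add0r.
    rewrite bform_congr => <-; apply: G0; apply/eqP => Ez.
    move/eqP: xn0; apply; move: Ez; rewrite /E /z mul_block_col !mulmx0 mul1mx.
    by rewrite !add0r => /(congr1 dsubmx); rewrite col_mxKd linear0.
  have [T HT] := IH H sH H0.
  exists (E *m block_mx (Num.sqrt a)^-1%:M 0 0 T).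
  rewrite trmx_mul !mulmxA -(mulmxA _ E^T) -(mulmxA _ _ E) GH.
  rewrite tr_block_mx !mulmx_block !trmx0 !mul0mx !mulmx0 !addr0 !add0r.
  rewrite !mul0mx HT tr_scalar_mx -!scalar_mxM (_ : _ * _ * _ = 1).
    by rewrite -scalar_mx_block.
  have sa : 0 < Num.sqrt a by rewrite sqrtr_gt0.
  rewrite -{2}(sqr_sqrtr (ltW a_gt0)); field; exact: lt0r_neq0.
by [].
Qed.

(** * Continuity of the determinant, and Cramer's rule *)

Lemma mulfun_continuous (R : realType) (T : topologicalType) (f g : T -> R) :
  continuous f -> continuous g -> continuous (fun t => f t * g t).
Proof. by move=> cf cg t; apply: cvgM; [exact: cf|exact: cg]. Qed.

Lemma sum_continuous (R : realType) (T : topologicalType) (I : finType)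
    (f : I -> T -> R) :
  (forall i, continuous (f i)) -> continuous (fun t => \sum_i f i t).
Proof.
by move=> cf t; apply: cvg_big => [|i _]; [exact: add_continuous|exact: cf].
Qed.

Lemma prod_continuous (R : realType) (T : topologicalType) (I : finType)
    (f : I -> T -> R) :
  (forall i, continuous (f i)) -> continuous (fun t => \prod_i f i t).
Proof.
by move=> cf t; apply: cvg_big => [|i _]; [exact: mul_continuous|exact: cf].
Qed.

(** [\det] unfolds to the Leibniz sum, a polynomial in the entries. *)
Lemma det_continuous (R : realType) n (T : topologicalType) (F : T -> 'M[R]_n) :
  (forall i j, continuous (fun t => F t i j)) ->
  continuous (fun t => \det (F t)).
Proof.
move=> cF; apply: sum_continuous => s; apply: mulfun_continuous.
  by move=> t; exact: cvg_cst.
by apply: prod_continuous => i; exact: cF.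
Qed.

(** Cramer's rule: for invertible [X], division by [\det X] gives coordinate [k] of [x] in the rows
    of [X] as a ratio of determinants. *)
Lemma mulmx_adj_row_subst (R : realType) n (X : 'M[R]_n) (x : 'rV[R]_n) k :
  (x *m \adj X) 0 k =
  \det (\matrix_(i, j) (if i == k then x 0 j else X i j)).
Proof.
rewrite (expand_det_row _ k) mxE; apply: eq_bigr => j _.
rewrite !mxE eqxx; congr (_ * (_ * \det _)).
by apply/matrixP => a b; rewrite !mxE eq_sym (negPf (neq_lift _ _)).
Qed.

(** * Compactness of the union of ellipsoids and a maximal determinant *)

(** For psd [A i] the condition says x^T x <= [A i] in the Loewner order. Quantifying over [y]
    presents each ellipsoid as an intersection of closed slabs, also when [A i] is singular. *)
Definition ellipsoid_union {R : realType} {n p : nat} (A : 'I_p -> 'M[R]_n)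
    (x : 'rV[R]_n) :=
  exists i, forall y : 'cV[R]_n, (x *m y) 0 0 ^+ 2 <= bform (A i) y y.

(** Each row ranges over a finite union of intersections of slabs. Matrices are flattened to row
    vectors, to which the extreme value theorem is applied below. *)
Lemma closed_ellipsoid_union_rows (R : realType) n p (A : 'I_p -> 'M[R]_n) :
  closed [set v : 'rV[R]_(n * n) |
           forall k, ellipsoid_union A (row k (vec_mx v))].
Proof.
have -> : [set v : 'rV[R]_(n * n) |
           forall k, ellipsoid_union A (row k (vec_mx v))] =
   \bigcap_(k in setT) \bigcup_(i in setT) \bigcap_(y in setT)
    (fun v : 'rV[R]_(n * n) => (row k (vec_mx v) *m y) 0 0 ^+ 2) @^-1`
      [set t | t <= bform (A i) y y].
  apply/seteqP; split=> v /= H k.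
    by move=> _; have [i Hi] := H k; exists i => // y _; apply: Hi.
  by have [i _ Hi] := H k I; exists i => y; apply: Hi.
apply: closed_bigI => k _; apply: closed_bigcup => [|i _].
  exact: finite_finset.
apply: closed_bigI => y _; apply: preimage_closed; last exact: closed_le.
have cy : continuous (fun v : 'rV[R]_(n * n) => (row k (vec_mx v) *m y) 0 0).
  have -> : (fun v : 'rV[R]_(n * n) => (row k (vec_mx v) *m y) 0 0) =
      (fun v => \sum_j v 0 (mxvec_index k j) * y j 0).
    by apply/funext => v; rewrite mxE; apply: eq_bigr => j _; rewrite !mxE.
  apply: sum_continuous => j; apply: mulfun_continuous.
    exact: coord_continuous.
  exact: cst_continuous.
by move=> v _; have := mulfun_continuous _ _ _ _ cy cy v.
Qed.

Lemma bounded_ellipsoid_union_rows (R : realType) n p (A : 'I_p -> 'M[R]_n) :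
  (forall i, psdmx (A i)) ->
  bounded_set [set v : 'rV[R]_(n * n) |
                forall k, ellipsoid_union A (row k (vec_mx v))].
Proof.
move=> psdA; pose c := \sum_i \tr (A i).
(* Testing on basis vectors bounds squared entries by [c], and any [b] above [c + 1] satisfies
   [c <= b ^+ 2]. *)
exists (c + 1); split; first exact: num_real.
move=> b cb v Cv; change (mx_norm v <= b); rewrite mx_normrE.
have c0 : 0 <= c by rewrite sumr_ge0 // => i _; exact: psdmx_trace_ge0.
have b0 : 0 <= b by rewrite (le_trans _ (ltW cb)) // addr_ge0.
apply: bigmax_le => // -[a t] _ /=.
rewrite (ord1 a); case/mxvec_indexP: t => k j.
have [i /(_ (delta_mx j 0))] := Cv k.
rewrite -colE !mxE bform_delta => sq.
have Aile : A i j j <= c by exact: psdmx_diag_le_sum_trace.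
have b2 : (v 0 (mxvec_index k j)) ^+ 2 <= b ^+ 2.
  apply: le_trans sq (le_trans Aile _); clear -cb c0 b0.
  nra.
by rewrite -sqrtr_sqr -(ger0_norm b0) -sqrtr_sqr ler_wsqrtr.
Qed.

Lemma max_det_ellipsoid_union (R : realType) n p (A : 'I_p -> 'M[R]_n)
    (X0 : 'M[R]_n) :
  (forall i, psdmx (A i)) -> (forall k, ellipsoid_union A (row k X0)) ->
  exists2 X : 'M[R]_n, forall k, ellipsoid_union A (row k X) &
    forall Y : 'M[R]_n, (forall k, ellipsoid_union A (row k Y)) ->
      `|\det Y| <= `|\det X|.
Proof.
move=> psdA X0A.
pose C := [set v : 'rV[R]_(n * n) |
            forall k, ellipsoid_union A (row k (vec_mx v))].
have C0 : C !=set0 by exists (mxvec X0); rewrite /C /= mxvecK.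
have cC : compact C.
  apply: bounded_closed_compact; first exact: bounded_ellipsoid_union_rows.
  exact: closed_ellipsoid_union_rows.
have cdet : continuous (fun v : 'rV[R]_(n * n) => \det (vec_mx v : 'M_n)).
  apply: det_continuous => i j.
  have -> : (fun v : 'rV[R]_(n * n) => (vec_mx v : 'M_n) i j) =
      (fun v => v 0 (mxvec_index i j)) by apply/funext => v; rewrite mxE.
  exact: coord_continuous.
have csq := mulfun_continuous _ _ _ _ cdet cdet.
have [v /set_mem Cv vmax] := EVT_max_rV C0 cC (continuous_subspaceT csq).
exists (vec_mx v) => [//|Y YA].
have := vmax (mxvec Y); rewrite mxvecK -!expr2 => /(_ _)/wrap[].
  by apply/mem_set; rewrite /C /= mxvecK.
by move=> YX; rewrite -!sqrtr_sqr ler_wsqrtr.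
Qed.

(** * Barycentric spanner of the union of ellipsoids *)

Lemma psdmx1 (R : realType) n : psdmx (1%:M : 'M[R]_n).
Proof.
split=> [|x]; first by rewrite trmx1.
by rewrite -/(bform _ x x) bform1 sumr_ge0 // => i _; rewrite sqr_ge0.
Qed.

Lemma bform1_gt0 (R : realType) n (x : 'cV[R]_n) :
  x != 0 -> 0 < bform 1%:M x x.
Proof.
move=> /matrix0Pn[i [j]]; rewrite (ord1 j) bform1 => xi0.
rewrite (bigD1 i) //= ltr_pwDl ?sumr_ge0 // => [|k _]; last exact: sqr_ge0.
by rewrite exprn_even_gt0.
Qed.

Lemma ellipsoid_union_psdmx (R : realType) n p (A : 'I_p -> 'M[R]_n) i
    (w : 'cV[R]_n) (a : R) : psdmx (A i) ->
  a ^+ 2 * bform (A i) w w <= 1 ->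
  ellipsoid_union A (a *: (w^T *m A i)).
Proof.
move=> psdA aw; exists i => y; rewrite -scalemxAl mxE exprMn -/(bform _ w y).
have y0 : 0 <= bform (A i) y y by apply: psdA.2.
apply: le_trans (ler_wpM2l (sqr_ge0 a) (psdmx_cauchy_schwarz _ _ _ w y psdA)) _.
by rewrite mulrA ler_piMl.
Qed.

(** The factor [n%:R] bounds the squared length of a vector of [n] coefficients in [-1, 1]. The
    second claim comes from the invertibility of the spanner. *)
Lemma psd_barycentric_spanner (R : realType) n p (A : 'I_p -> 'M[R]_n) :
  (forall i, psdmx (A i)) -> row_full (\mxcol_i A i) ->
  exists f : 'I_n -> 'I_p,
    (forall i y, bform (A i) y y <= n%:R * \sum_k bform (A (f k)) y y) /\
    (forall y, y != 0 -> 0 < \sum_k bform (A (f k)) y y).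
Proof.
move=> psdA fullA; have q0 i y : 0 <= bform (A i) y y by apply: (psdA i).2.
pose t := \sum_i \tr (A i); pose c := (1 + t)^-1.
have t0 : 0 <= t by rewrite sumr_ge0 // => i _; exact: psdmx_trace_ge0.
have c0 : 0 < c by rewrite invr_gt0 ltr_pwDl.
have ct : c * (1 + t) = 1 by rewrite mulVf // gt_eqF // ltr_pwDl.
have Ale i j : A i j j <= t by exact: psdmx_diag_le_sum_trace.
have [X XA Xmax] : exists2 X : 'M[R]_n,
    forall k, ellipsoid_union A (row k X) & \det X != 0.
  (* A starting point with nonzero determinant: independent rows of the [A i], shrunk into the
     ellipsoids since [c ^+ 2 * t <= 1]. *)
  exists (c *: rowsub (fullrankfun fullA) (\mxcol_i A i)); last first.
    rewrite detZ; apply: mulf_neq0; first by rewrite expf_neq0 // gt_eqF.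
    by rewrite -unitfE -unitmxE fullrowsub_unit.
  move=> k; rewrite linearZ /= row_rowsub row_mxcol rowE -trmx_delta.
  apply: ellipsoid_union_psdmx => //; rewrite bform_delta.
  apply: le_trans (ler_wpM2l (sqr_ge0 c) (Ale _ _)) _; clear -t0 c0 ct; nra.
have {X XA Xmax} [X XA [X0 Xmax]] : exists2 X : 'M[R]_n,
    forall k, ellipsoid_union A (row k X) & \det X != 0 /\
    forall Y : 'M[R]_n, (forall k, ellipsoid_union A (row k Y)) ->
      `|\det Y| <= `|\det X|.
  have [Y YA Ymax] := max_det_ellipsoid_union _ _ _ _ X psdA XA.
  exists Y => //; split=> //; rewrite -normr_gt0.
  by rewrite (lt_le_trans _ (Ymax X XA)) // normr_gt0.
have uX : X \in unitmx by rewrite unitmxE unitfE.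
have [f fP] := choice XA; exists f.
have rowX k (y : 'cV[R]_n) : (row k X *m y) 0 0 = (X *m y) k 0.
  by rewrite -row_mul mxE.
have sumX y : bform 1%:M (X *m y) (X *m y) <= \sum_k bform (A (f k)) y y.
  by rewrite bform1; apply: ler_sum => k _; rewrite -rowX.
split=> [i y|y yn0]; last first.
  apply: lt_le_trans (sumX y); apply: bform1_gt0.
  by apply: contra yn0 => /eqP Xy; rewrite -(mulKmx uX y) Xy mulmx0.
have [->|b_neq0] := eqVneq (bform (A i) y y) 0.
  by rewrite mulr_ge0 // sumr_ge0.
have b_gt0 : 0 < bform (A i) y y by rewrite lt_neqAle eq_sym b_neq0 q0.
set b := bform _ _ _ in b_neq0 b_gt0 *.
(* The point of the ellipsoid of [A i] where the functional [y] takes its largest value,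
   [Num.sqrt b]; this normalisation is why [b = 0] was set aside. *)
pose x : 'rV[R]_n := (Num.sqrt b)^-1 *: (y^T *m A i).
have sb2 : Num.sqrt b ^+ 2 = b by rewrite sqr_sqrtr // ltW.
have xA : ellipsoid_union A x.
  by apply: ellipsoid_union_psdmx => //; rewrite exprVn sb2 mulVf.
pose g := x *m invmx X.
(* Replacing row [k] of [X] by [x] keeps all rows in the union, so the absolute determinant cannot
   increase. *)
have g1 k : `|g 0 k| <= 1.
  have -> : g 0 k = (\det X)^-1 *
      \det (\matrix_(i, j) (if i == k then x 0 j else X i j)).
    by rewrite -mulmx_adj_row_subst /g /invmx uX -scalemxAr mxE.
  rewrite normrM normfV ler_pdivrMl ?normr_gt0 // mulr1; apply: Xmax => l.
  have [->|lk] := eqVneq l k.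
    by congr ellipsoid_union: xA; apply/rowP => j; rewrite !mxE eqxx.
  by congr ellipsoid_union: (XA l); apply/rowP => j; rewrite !mxE (negPf lk).
(* Since [x = g *m X], this is the value [x *m y]; Cauchy-Schwarz then bounds [b] by the squared
   lengths of [g] and [X *m y]. *)
have gE : bform 1%:M g^T (X *m y) = Num.sqrt b.
  rewrite /bform trmxK mulmx1 mulmxA mulmxKV // -scalemxAl mxE -/(bform _ y y).
  by rewrite -/b -{2}sb2 expr2 mulKf // sqrtr_eq0 -ltNge.
have gn : bform 1%:M g^T g^T <= n%:R.
  rewrite bform1; apply: le_trans (_ : \sum_(k < n) 1 <= _).
    apply: ler_sum => k _; rewrite mxE -(real_normK (num_real _)).
    by rewrite expr_le1.
  by rewrite sumr_const card_ord.
have := psdmx_cauchy_schwarz _ _ _ g^T (X *m y) (psdmx1 _ _).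
rewrite gE sb2 => /le_trans; apply; apply: ler_pM => //; exact: (psdmx1 _ _).2.
Qed.

(** * Compression of a factorization, and bounds on entries and means *)

(** The rows of all [A i] lie in the row space of [E], so compressing them by [F] and the [B j] by
    [E] preserves the traces. For a factorization of minimal size this forces full column rank. *)
Lemma psd_factorization_rank (R : realType) p q r (M : 'M[R]_(p, q))
    (A : 'I_p -> 'M[R]_r) (B : 'I_q -> 'M[R]_r) :
  (forall i, psdmx (A i)) -> (forall j, psdmx (B j)) ->
  (forall i j, M i j = \tr (A i *m B j)) ->
  has_psd_factorization M (\rank (\mxcol_i A i)).
Proof.
move=> psdA psdB ME; pose E := row_base (\mxcol_i A i).
pose F := pinvmx E.
have AFE i : A i *m F *m E = A i.
  apply: mulmxKpV; rewrite eq_row_base; apply/row_subP => k.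
  by rewrite -[A i](mxcolK A i) row_rowsub row_sub.
have EFA i : E^T *m F^T *m A i = A i.
  by rewrite -{1}(psdA i).1 -mulmxA -!trmx_mul AFE (psdA i).1.
clearbody F E.
exists (fun i => F^T *m A i *m F), (fun j => E *m B j *m E^T).
split=> [i|j|i j].
- exact: psdmx_congr.
- by rewrite -{1}[E]trmxK; apply: psdmx_congr.
- by rewrite ME !mulmxA [RHS]mxtrace_mulC !mulmxA EFA AFE.
Qed.

Lemma le_mx_norm (R : realType) p q (M : 'M[R]_(p, q)) i j :
  M i j <= mx_norm M.
Proof.
rewrite mx_normrE; apply: le_trans (ler_norm _) _.
exact: (le_bigmax _ (fun ij : 'I_p * 'I_q => `|M ij.1 ij.2|) (i, j)).
Qed.

Lemma le_mean (R : realType) n (F : 'I_n.+1 -> R) (c : R) :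
  (forall i, F i <= c) -> n.+1%:R^-1 * \sum_i F i <= c.
Proof.
move=> Fc; rewrite ler_pdivrMl ?ltr0n //.
apply: le_trans (ler_sum _ (fun i _ => Fc i)) _.
by rewrite sumr_const card_ord mulr_natl.
Qed.

(** * Rescaling of a minimal factorization *)

Theorem theorem3p3 (R : realType) (p q : nat) (M : 'M[R]_(p, q))
    (M_ge0 : nonneg_mx M) (eta : R) (eta_gt0 : 0 < eta) (eta_le1 : eta <= 1) :
  exists (d : nat) (P : 'I_p -> 'M[R]_d) (Q : 'I_q -> 'M[R]_d),
    (forall i, psdmx (P i)) /\
    (forall j, psdmx (Q j)) /\
    (forall i j, M i j <= \tr (P i *m Q j) /\
                 \tr (P i *m Q j) <= M i j + eta * mx_norm M) /\
    p%:R^-1 *: (\sum_i P i) = 1%:M /\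
    (forall i, opnorm (P i) <= 2 * (psd_rank M)%:R ^+ 2 / eta) /\
    (forall j, loewner_le (Q j)
       ((mx_norm M * (eta + (psd_rank M)%:R ^+ 2) * (psd_rank M)%:R)
          *: uniform_density d)).
Proof.
have [[A [B [psdA psdB ME]]] rmin] := psd_rankP M_ge0.
move: (psd_rank M) A B psdA psdB ME rmin => r A B psdA psdB ME rmin.
have m0 : 0 <= mx_norm M.
  rewrite mx_normrE; apply: (big_ind (fun x => 0 <= x)) => // x y.
  by rewrite le_max => ->.
have fullA : row_full (\mxcol_i A i).
  rewrite /row_full eqn_leq rank_leq_col rmin //.
  exact: psd_factorization_rank.
have [f [Af Sf]] := psd_barycentric_spanner _ _ _ _ psdA fullA.
case: r A B psdA psdB ME {rmin fullA} f Af Sf => [|r] A B psdA psdB ME f Af Sf.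
  (* For psd rank 0 the entries of [M] are empty traces, and 0 by 0 matrices satisfy every
     condition. *)
  exists 0%N, (fun=> 0), (fun=> 0).
  have psd0 (N : 'M[R]_0) : psdmx N.
    split=> [|x]; first by apply/matrixP => -[].
    by rewrite mxE big_ord0.
  do 2![split=> //]; split=> [i j|].
    by rewrite ME /mxtrace !big_ord0 add0r mulr_ge0 // ltW.
  split; first by apply/matrixP => -[].
  split=> [i|j]; last exact: psd0.
  rewrite expr0n mulr0 mul0r; apply: opnorm_le => // x.
  by rewrite /bform !mxE big_ord0 mul0r.
case: p M M_ge0 A psdA ME f Af Sf m0 => [|p] M M_ge0 A psdA ME f Af Sf m0.
  (* [p = 0] is excluded because [f] maps a nonempty type to ['I_p]. *)
  by case: (f 0).
set r1 := r.+1%:R : R.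
have r1_ge1 : 1 <= r1 by rewrite ler1n.
pose S : 'M[R]_r.+1 := r1^-1 *: \sum_k A (f k).
pose G : 'M[R]_r.+1 := p.+1%:R^-1 *: (\sum_i A i) + eta *: S.
have psdS : psdmx S by apply: psdmxZ; [rewrite invr_ge0; lra|exact: psdmx_sum].
have SE y : bform S y y = r1^-1 * \sum_k bform (A (f k)) y y.
  by rewrite bformMZ bformMsum.
have AS i y : bform (A i) y y <= r1 ^+ 2 * bform S y y.
  by apply: le_trans (Af i y) _; rewrite SE mulrA expr2 mulfK // gt_eqF //; lra.
have S0 y : y != 0 -> 0 < bform S y y.
  by move=> y0; rewrite SE mulr_gt0 ?invr_gt0 ?Sf //; lra.
have psdavg : psdmx (p.+1%:R^-1 *: (\sum_i A i)).
  by apply: psdmxZ; [rewrite invr_ge0|exact: psdmx_sum].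
have SG y : eta * bform S y y <= bform G y y.
  by rewrite -bformMZ bformMD lerDr; apply: psdavg.2.
have psdG : psdmx G by apply: psdmxD => //; apply: psdmxZ => //; exact: ltW.
have G0 y : y != 0 -> 0 < bform G y y.
  by move=> y0; apply: lt_le_trans (SG y); rewrite mulr_gt0 ?S0.
have trSB j : 0 <= \tr (S *m B j) /\ \tr (S *m B j) <= mx_norm M.
  rewrite -scalemxAl mxtraceZ mulmx_suml raddf_sum /=.
  under eq_bigr do rewrite -ME.
  split; last by apply: le_mean => k; exact: le_mx_norm.
  by rewrite mulr_ge0 ?invr_ge0 ?sumr_ge0.
clearbody S.
have [T TG] := posdef_congr1 _ _ _ psdG.1 G0.
have [_ uT] := mulmx1_unit TG.
pose V := invmx T.
pose P i := T^T *m (A i + eta *: S) *m T.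
pose Q j := V *m B j *m V^T.
have psdP i : psdmx (P i).
  by apply: psdmx_congr; apply: psdmxD => //; apply: psdmxZ => //; exact: ltW.
have psdQ j : psdmx (Q j).
  by rewrite /Q -{1}[V]trmxK; apply: psdmx_congr.
have VT : V^T *m T^T = 1%:M by rewrite -trmx_mul mulmxV // trmx1.
(* By cyclicity of the trace [T] and [V] cancel; used with [N = A i + eta *: S] and [N = G]. *)
have trTV (N : 'M[R]_r.+1) j : \tr (T^T *m N *m T *m Q j) = \tr (N *m B j).
  rewrite /Q !mulmxA mxtrace_mulC !mulmxA VT mul1mx.
  by rewrite -(mulmxA N T V) mulmxV // mulmx1.
have trQ j : \tr (Q j) <= mx_norm M * (eta + 1).
  rewrite -[Q j]mul1mx -TG trTV /G mulmxDl mxtraceD -!scalemxAl !mxtraceZ.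
  rewrite mulmx_suml raddf_sum /=; under eq_bigr do rewrite -ME.
  rewrite mulrDr mulr1 [mx_norm M * eta]mulrC [leRHS]addrC lerD //.
    by apply: le_mean => i; exact: le_mx_norm.
  by apply: ler_wpM2l; [exact: ltW|exact: (trSB j).2].
exists r.+1, P, Q; do 2![split=> //].
split.
  move=> i j; rewrite /P trTV mulmxDl mxtraceD -ME -scalemxAl mxtraceZ.
  have [S_ge0 S_le] := trSB j; have e0 := ltW eta_gt0.
  by rewrite lerDl lerD2l mulr_ge0 // ler_wpM2l.
split.
  rewrite -TG /P -mulmx_suml -mulmx_sumr scalemxAl scalemxAr big_split /=.
  rewrite sumr_const card_ord scalerDr -[eta *: S *+ _]scaler_nat.
  by rewrite scalerK ?pnatr_eq0.
split=> [i|j].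
  apply: opnorm_le => //.
    by rewrite divr_ge0 ?(ltW eta_gt0) // mulr_ge0 // sqr_ge0.
  move=> x; rewrite -TG !bform_congr; set y := T *m x.
  rewrite bformMD bformMZ mulrAC ler_pdivlMr //.
  have Sy : 0 <= bform S y y by apply: psdS.2.
  have Gy : 0 <= bform G y y by apply: psdG.2.
  (* From [eta <= 1 <= r1]: absorbing [eta] into [r1 ^+ 2] produces the factor 2. *)
  have r2 : eta <= r1 ^+ 2 by nra.
  have H1 : bform (A i) y y + eta * bform S y y <= 2 * r1 ^+ 2 * bform S y y.
    by have := AS i y; have := ler_wpM2r Sy r2; lra.
  have := ler_wpM2r (ltW eta_gt0) H1.
  have := ler_wpM2l (_ : 0 <= 2 * r1 ^+ 2) (SG y).
  by rewrite mulr_ge0 ?sqr_ge0 // => /(_ isT); lra.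
(* The identity has trace [r1], so the factor [r1] cancels the normalisation of the uniform
   density. *)
have cE : (mx_norm M * (eta + r1 ^+ 2) * r1) *: uniform_density r.+1 =
    (mx_norm M * (eta + r1 ^+ 2)) *: (1%:M : 'M[R]_r.+1).
  rewrite /uniform_density mxtrace1 scalerA -/r1 mulfK // gt_eqF //; lra.
rewrite /loewner_le cE; split=> [|x].
  by rewrite linearB linearZ /= trmx1 (psdQ j).1.
rewrite -/(bform _ x x) -scaleN1r bformMD !bformMZ.
have x0 : 0 <= bform 1%:M x x by apply: (psdmx1 _ _).2.
have := psdmx_le_trace _ _ _ x (psdQ j).
(* The trace bound has the constant [eta + 1], enlarged to the claimed one by [1 <= r1 ^+ 2]. *)
have : mx_norm M * (eta + 1) <= mx_norm M * (eta + r1 ^+ 2).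
  by apply: ler_wpM2l => //; nra.
move=> /(le_trans (trQ j))/(ler_wpM2r x0); lra.
Qed.
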